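(* Let $d\ge 2$. Consider Brochette first-passage percolation on $\mathbb{Z}^d$ with passage-time distribution function $F$, and let $a$ be the infimum of the support of the passage-time distribution. Assume that $a>0$ and that $F(t)\sim c\,(t-a)^{\beta}$ as $t\to a^+$ (i.e. $F(t)/(c\,(t-a)^\beta)\to 1$), where $\beta>0$ and $c>0$. Assume also that $$\mathbb{E}\big[\min(\tau_1^{d},\dots,\tau_d^{d})\big]<+\infty ,$$ where $\tau_1,\dots,\tau_d$ are i.i.d. random variables with distribution function $F$ (and $\tau_i^d$ is the $d$-th power of $\tau_i$). Then for all $\eta>0$ there exist $\varepsilon,K>0$ such that $$\liminf_{n\to+\infty}\mathbb{P}\left(\varepsilon\, n^{\frac{\beta}{\beta+d-1}}\le H_n\le K\, n^{\frac{\beta}{\beta+d-1}}\right)\ge 1-\eta .$$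
   Context: Lattice and paths. $\mathbb{Z}^d$ is equipped with the edge set $\mathbb{E}^d=\{\{x,y\}: x,y\in\mathbb{Z}^d,\ \|x-y\|_1=1\}$, and $(e_1,\dots,e_d)$ is the canonical basis of $\mathbb{R}^d$; $x_i$ denotes the $i$-th coordinate of $x$. A path is a (finite or infinite) sequence of edges such that consecutive edges share exactly one endpoint. Brochette first-passage percolation. An integer line is the set of points of $\mathbb{Z}^d$ lying on a common axis-parallel line of $\mathbb{R}^d$ (a line $x+\mathbb{Z}e_i$ with $x\in\mathbb{Z}^d$). Let $\Delta$ be the set of all integer lines, and let $(\tau_\delta)_{\delta\in\Delta}$ be i.i.d. non-negative real random variables with common cumulative distribution function $F$. Each edge $e\in\mathbb{E}^d$ belongs to a unique integer line $\delta$ (the one containing both its endpoints), and its passage time is $\tau_e:=\tau_\delta$; so all edges on the same line share the same passage time. The infimum $a\ge 0$ of the support of the passage-time distribution is characterized by $F(a+\varepsilon)>0$ and $F(a-\varepsilon)=0$ for all $\varepsilon>0$. Passage times and geodesics. The passage time of a path $\Gamma$ is $T(\Gamma)=\sum_{e\in\Gamma}\tau_e$. For $x,y\in\mathbb{Z}^d$, $T(x,y)=\inf_\Gamma T(\Gamma)$, the infimum being over all paths $\Gamma$ from $x$ to $y$. A path $\gamma$ from $x$ to $y$ is a geodesic from $x$ to $y$ if $T(\gamma)=T(x,y)$. Height. For a path $\gamma$ starting from $0$, its height is $$H(\gamma):=\max_{x\in e,\ e\in\gamma}\|x-x_1e_1\|_1 ,$$ the maximum being over all vertices $x$ that are endpoints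 of edges of $\gamma$. For $n\in\mathbb{N}$, $H_n:=\max_{\Gamma_n}H(\Gamma_n)$, where the maximum is over all geodesics $\Gamma_n$ from $0$ to $ne_1$ (under the hypotheses of the theorem, geodesics between all pairs of vertices exist almost surely). *)

(* Defs.v *)
From mathcomp Require Import all_boot all_order all_algebra finmap.
From mathcomp Require Import all_classical all_reals all_analysis.
From mathcomp Require Import zify.

Set Implicit Arguments.
Unset Strict Implicit.
Unset Printing Implicit Defensive.

Import Order.TTheory GRing.Theory Num.Theory.
Import numFieldNormedType.Exports.

Local Open Scope classical_set_scope.
Local Open Scope ring_scope.

Section Probability.
Context {dT : measure_display} {T : measurableType dT} {R : realType}.
Variable P : probability T R.

(* Only the variables with index in [D] are constrained. *)
Definition mutually_independent (I : choiceType) (D : set I)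
    (X : I -> {RV P >-> R}) : Prop :=
  forall (J : {fset I}) (B : I -> set R),
    [set` J] `<=` D -> (forall i, measurable (B i)) ->
    P (\bigcap_(i in [set` J]) X i @^-1` B i) =
    (\prod_(i <- J) P (X i @^-1` B i))%E.

Definition iid_with_cdf (I : choiceType) (D : set I)
    (X : I -> {RV P >-> R}) (F : R -> R) : Prop :=
  mutually_independent D X /\
  forall i, D i -> forall t, cdf (X i) t = (F t)%:E.

End Probability.

Definition is_support_inf (R : realType) (F : R -> R) (a : R) : Prop :=
  forall eps, 0 < eps -> 0 < F (a + eps) /\ F (a - eps) = 0.

Section Lattice.
Variable d : nat.
Notation Zd := 'rV[int]_d.

Definition basis_vec (i : 'I_d) : Zd := delta_mx 0 i.

Definition l1norm (x : Zd) : nat := (\sum_(i < d) `|x 0%R i|)%N.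

Definition is_edge (e : {fset Zd}) : Prop :=
  exists x y : Zd, e = [fset x; y]%fset /\ l1norm (x - y) = 1%N.

Definition integer_lines : set (set Zd) :=
  [set L | exists (x : Zd) (i : 'I_d),
    L = range (fun k : int => x + k *: basis_vec i)].

(* The line containing both endpoints of an edge; see [line_of_edge_unique]. *)
Definition line_of_edge (e : {fset Zd}) : set Zd :=
  xget set0 [set L | integer_lines L /\ [set` e] `<=` L].

Definition is_path (p : seq {fset Zd}) : Prop :=
  (forall e, e \in p -> is_edge e) /\
  sorted (fun e f : {fset Zd} => #|` (e `&` f)%fset| == 1%N) p.

(* [p] is the sequence of edges {x, v_1}, {v_1, v_2}, ..., {v_(k-1), y}; the
   empty path joins x to x. *)
Definition path_from_to (x y : Zd) (p : seq {fset Zd}) : Prop :=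
  is_path p /\
  exists v : seq Zd, p = pairmap (fun u w => [fset u; w]%fset) x v /\
                     last x v = y.

(* [i1] is the index of the first coordinate. *)
Definition height (i1 : 'I_d) (p : seq {fset Zd}) : nat :=
  (\max_(e <- p) \max_(x <- e) l1norm (x - x 0 i1 *: basis_vec i1)%R)%N.

Section PassageTimes.
Variables (R : realType) (tau : set Zd -> R).

Definition edge_time (e : {fset Zd}) : R := tau (line_of_edge e).

Definition passage_time (p : seq {fset Zd}) : R := \sum_(e <- p) edge_time e.

Definition point_time (x y : Zd) : R :=
  inf [set passage_time p | p in path_from_to x y].

Definition geodesic (x y : Zd) (p : seq {fset Zd}) : Prop :=
  path_from_to x y p /\ passage_time p = point_time x y.

(* H_n as an extended real: where the maximum over geodesics exists the two
   coincide, and it is infinite when there is no geodesic or when the heights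
   of geodesics are unbounded. *)
Definition max_height (i1 : 'I_d) (n : nat) : \bar R :=
  ereal_sup [set ((height i1 p)%:R)%:E | p in
    geodesic 0 (n%:Z *: basis_vec i1)].

End PassageTimes.

Lemma basis_vecE (i j : 'I_d) : basis_vec i 0 j = (j == i)%:R.
Proof. by rewrite /basis_vec mxE eqxx. Qed.

Lemma l1norm_eq1 (z : Zd) : l1norm z = 1%N ->
  exists (i : 'I_d) (s : int), z = s *: basis_vec i /\ `|s|%N = 1%N.
Proof.
move=> z1.
have [i zi|z0] := pickP (fun i => z 0 i != 0); last first.
  move: z1; rewrite /l1norm big1// => i _.
  by move/negbFE/eqP: (z0 i) => ->.
move: z1; rewrite /l1norm (bigD1 i)//= => z1.
have zi0 : (0 < `|z 0%R i|)%N by rewrite absz_gt0.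
have [zi1 r0] : `|z 0%R i|%N = 1%N /\
    (\sum_(j < d | j != i) `|z 0%R j|)%N = 0%N.
  by move: z1 zi0; case: `|_|%N => [|[|m]] //=; rewrite add1n => -[->].
exists i, (z 0 i); split => //.
apply/rowP => j; rewrite mxE basis_vecE.
have [->|ji] := eqVneq j i; first by rewrite mulr1.
rewrite mulr0; apply/eqP; rewrite -absz_eq0.
by move/eqP: r0; rewrite sum_nat_eq0 => /forallP/(_ j); rewrite ji.
Qed.

Lemma line_of_edge_unique (e : {fset Zd}) : is_edge e ->
  exists! L, integer_lines L /\ [set` e] `<=` L.
Proof.
move=> [x [y [-> /l1norm_eq1[i [s [xy s1]]]]]].
have yE : y = x + (- s) *: basis_vec i.
  by rewrite scaleNr -xy opprB addrC subrK.
exists (range (fun k : int => x + k *: basis_vec i)); split.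
  split; first by exists x, i.
  move=> z /=; rewrite !inE => /orP[/eqP->|/eqP->].
    by exists 0 => //; rewrite scale0r addr0.
  by exists (- s) => //; rewrite -yE.
move=> L [[w [j ->]] sub].
have [k _ kx] : range (fun k : int => w + k *: basis_vec j) x.
  by apply: sub; rewrite /= !inE eqxx.
have [l _ ly] : range (fun k : int => w + k *: basis_vec j) y.
  by apply: sub; rewrite /= !inE eqxx orbT.
have ij : i = j.
  apply/eqP/negPn/negP => ij.
  have /rowP/(_ i) : x - y = (k - l) *: basis_vec j.
    by rewrite -kx -ly scalerBl opprD addrACA subrr add0r.
  rewrite xy !mxE !eqxx (negbTE ij) /=; lia.
rewrite -ij in kx *.
apply/seteqP; split => z [m _ <-].
  by exists (m + k) => //; rewrite -kx scalerDl addrA addrAC.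
by exists (m - k) => //; rewrite -kx -addrA -scalerDl [k + _]addrC subrK.
Qed.

Lemma line_of_edgeP (e : {fset Zd}) : is_edge e ->
  integer_lines (line_of_edge e) /\ [set` e] `<=` line_of_edge e.
Proof.
move=> /line_of_edge_unique[L [LP _]].
exact: (@xgetI _ set0 [set M | integer_lines M /\ [set` e] `<=` M] L LP).
Qed.

End Lattice.

(* Main.v *)
Require Import Defs.
From mathcomp Require Import all_boot all_order all_algebra finmap.
From mathcomp Require Import all_classical all_reals all_analysis.
From mathcomp Require Import zify ring lra.

(* Let h = n^(beta/(beta+d-1)) and delta = h/n, so that delta^beta = h^-(d-1).
   Among the axial lines (direction e_1) within distance O(h) of the axis there
   is, with high probability, one of time at most a + delta.  Taking the first
   such line in a fixed enumeration of a box, the 2(d-1) lines that connect it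
   to 0 and n e_1 are independent of the choice, hence have times at most a
   constant M with high probability, and T(0, n e_1) <= a n + C h.
   A geodesic of height H has at least n + H edges, all of time at least a, so
   H <= C h / a.  Conversely, by a union bound, for eps small no axial line
   within eps h of the axis has time at most a + 2 C delta, so that a path of
   height at most eps h would take time at least a n + 2 C h. *)

Import Order.TTheory GRing.Theory Num.Theory.
Import numFieldNormedType.Exports.

Local Open Scope classical_set_scope.
Local Open Scope ring_scope.

(** * Walks on the lattice, their passage times, and existence of geodesics *)

Section Walks.
Local Set Implicit Arguments.
Local Unset Strict Implicit.
Local Unset Printing Implicit Defensive.
Context {d : nat}.
Notation Zd := 'rV[int]_d.
Implicit Types (x y u w z : Zd) (v : seq Zd) (i : 'I_d).

Lemma l1normN x : l1norm (- x) = l1norm x.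
Proof. by apply: eq_bigr => i _; rewrite mxE abszN. Qed.

Lemma l1normBC x y : l1norm (x - y) = l1norm (y - x).
Proof. by rewrite -l1normN opprB. Qed.

Lemma l1norm0 : l1norm (0 : Zd) = 0%N.
Proof. by rewrite /l1norm big1// => i _; rewrite mxE. Qed.

Lemma ler_l1normD x y : (l1norm (x + y) <= l1norm x + l1norm y)%N.
Proof. rewrite /l1norm -big_split; apply: leq_sum => i _ /=; rewrite mxE.
by move: (x 0 i) (y 0 i) => s t; lia. Qed.

Lemma leq_abs_l1norm x i : (`|x 0%R i| <= l1norm x)%N.
Proof. by rewrite /l1norm (bigD1 i)//= leq_addr. Qed.

Lemma l1norm_basis (s : int) i : l1norm (s *: basis_vec i) = `|s|%N.
Proof.
rewrite /l1norm (bigD1 i)//= mxE basis_vecE eqxx mulr1 big1 ?addn0// => j ji.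
by rewrite mxE basis_vecE (negbTE ji) mulr0.
Qed.

Definition adjacent x y := l1norm (x - y) == 1%N.

Lemma adjacentC x y : adjacent x y = adjacent y x.
Proof. by rewrite /adjacent l1normBC. Qed.

Lemma adjacent_neq x y : adjacent x y -> x != y.
Proof. by apply: contraTneq => ->; rewrite /adjacent subrr l1norm0. Qed.

Lemma adjacentP x y : adjacent x y ->
  exists i s, y = x + s *: basis_vec i /\ `|s|%N = 1%N.
Proof.
rewrite adjacentC => /eqP/l1norm_eq1[i [s [yx s1]]]; exists i, s.
by rewrite -yx addrC subrK.
Qed.

Lemma adjacent_basis x i s : `|s|%N = 1%N -> adjacent x (x + s *: basis_vec i).
Proof. by move=> s1; rewrite adjacentC /adjacent addrAC subrr add0r l1norm_basis s1. Qed.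

Definition line x i : set Zd := range (fun k : int => x + k *: basis_vec i).

Lemma integer_line x i : integer_lines (line x i).
Proof. by exists x, i. Qed.

Lemma line_shift x i k : line (x + k *: basis_vec i) i = line x i.
Proof.
apply/seteqP; split => _ [m _ <-].
  by exists (k + m) => //; rewrite scalerDl addrA.
by exists (m - k) => //; rewrite scalerBl addrA addrAC addrK.
Qed.

(** [line_of_edge] is a choice among sets, so it is computed through the uniqueness of the line
    containing the edge. *)
Lemma line_of_step x i s : `|s|%N = 1%N ->
  line_of_edge [fset x; (x + s *: basis_vec i)%R]%fset = line x i.
Proof.
move=> s1; set e := [fset _; _]%fset.
have ee : is_edge e.
  by exists x, (x + s *: basis_vec i); split=> //; apply/eqP/adjacent_basis.
have [L [_ uniqL]] := line_of_edge_unique ee.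
rewrite -(uniqL _ (line_of_edgeP ee)); apply: uniqL; split.
  exact: integer_line.
move=> z /=; rewrite !inE => /orP[|] /eqP->.
  by exists 0 => //; rewrite scale0r addr0.
by exists s.
Qed.

(** A walk is a start [x] with the list [v] of its later vertices. The condition [path adjacent x v]
    allows backtracks, which [is_path] forbids, so walks can be concatenated freely. *)
Definition edges x v : seq {fset Zd} := pairmap (fun u w => [fset u; w]%fset) x v.

(** The witnesses of [is_edge] are [u] and [w] in either order; the other cases of the membership
    analysis would identify the two endpoints of an edge. *)
Lemma is_edge_adjacent u w : is_edge [fset u; w]%fset -> adjacent u w.
Proof.
move=> [x [y [exy /eqP xy1]]].
have xy : adjacent x y by [].
have ux : u \in [fset x; y]%fset by rewrite -exy !inE eqxx.
have wx : w \in [fset x; y]%fset by rewrite -exy !inE eqxx orbT.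
have xu : x \in [fset u; w]%fset by rewrite exy !inE eqxx.
have yu : y \in [fset u; w]%fset by rewrite exy !inE eqxx orbT.
move: ux wx xu yu; rewrite !inE => /orP[]/eqP-> /orP[]/eqP-> //.
- by rewrite orbb => _; rewrite orbb eq_sym (negbTE (adjacent_neq xy)).
- by rewrite adjacentC.
- by rewrite orbb (negbTE (adjacent_neq xy)).
Qed.

Lemma adjacent_is_edge u w : adjacent u w -> is_edge [fset u; w]%fset.
Proof. by move=> /eqP uw; exists u, w. Qed.

Lemma edges_adjacent x v : (forall e, e \in edges x v -> is_edge e) ->
  path adjacent x v.
Proof.
elim: v x => //= w v IH x H; rewrite is_edge_adjacent ?IH//.
  by move=> e ev; apply: H; rewrite inE ev orbT.
by apply: H; rewrite inE eqxx.
Qed.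

Lemma walk_edges x v : path adjacent x v ->
  forall e, e \in edges x v -> is_edge e.
Proof.
elim: v x => //= w v IH x /andP[xw wv] e; rewrite inE => /orP[/eqP->|].
  exact: adjacent_is_edge.
exact: IH.
Qed.

Lemma path_from_to_walk x y p : path_from_to x y p ->
  exists v, [/\ p = edges x v, path adjacent x v & last x v = y].
Proof.
move=> [[pe _] [v [pE vy]]]; exists v; split => //.
by apply: edges_adjacent; rewrite /edges -pE.
Qed.

Definition share1 (e f : {fset Zd}) := #|` (e `&` f)%fset| == 1%N.

Lemma share1_edges x w u : adjacent x w -> adjacent w u -> x != u ->
  share1 [fset x; w]%fset [fset w; u]%fset.
Proof.
move=> xw wu xu; rewrite /share1.
suff -> : ([fset x; w] `&` [fset w; u] = [fset w])%fset by rewrite cardfs1.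
apply/fsetP => z; rewrite !inE.
have [->|zw] := eqVneq z w; first by rewrite orbT.
by rewrite orbF /=; have [->|//] := eqVneq z x; rewrite (negbTE xu).
Qed.

Section Times.
Variables (R : realType) (tau : set Zd -> R).
Hypothesis tau_ge0 : forall L, integer_lines L -> 0 <= tau L.

Lemma edge_time_ge0 e : is_edge e -> 0 <= edge_time tau e.
Proof. by move=> /line_of_edgeP[eL _]; exact: tau_ge0. Qed.

Definition walk_time x v : R := passage_time tau (edges x v).

Lemma walk_time_nil x : walk_time x [::] = 0.
Proof. by rewrite /walk_time /passage_time big_nil. Qed.

Lemma walk_time_cons x w v :
  walk_time x (w :: v) = edge_time tau [fset x; w]%fset + walk_time w v.
Proof. by rewrite /walk_time /passage_time /= big_cons. Qed.

Lemma walk_time_cat x v1 v2 :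
  walk_time x (v1 ++ v2) = walk_time x v1 + walk_time (last x v1) v2.
Proof. by rewrite /walk_time /edges pairmap_cat /passage_time big_cat. Qed.

(* An edge sharing two endpoints with its predecessor is a backtrack; erasing
   both can only lower the time. *)
Lemma erase_backtracks x v : path adjacent x v ->
  exists v', [/\ path adjacent x v', last x v' = last x v,
    sorted share1 (edges x v') & walk_time x v' <= walk_time x v].
Proof.
elim: v x => [|w v IH] x; first by exists [::].
move=> /= /andP[xw wv]; have [[|u v'] [av' lv' sv' tv']] := IH _ wv.
  exists [:: w]; split; rewrite //= ?xw// !walk_time_cons.
  by rewrite lerD2l walk_time_nil -(walk_time_nil w).
have [xu|xu] := eqVneq x u.
  move: av' => /= /andP[wu uv]; rewrite -{}xu in tv' sv' lv' wu uv *.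
  exists v'; split => //.
    by move: sv' => /=; exact: path_sorted.
  rewrite walk_time_cons; apply: le_trans (_ : walk_time w (x :: v') <= _).
    by rewrite walk_time_cons lerDr edge_time_ge0//; exact: adjacent_is_edge.
  by apply: le_trans tv' _; rewrite lerDr edge_time_ge0//; exact: adjacent_is_edge.
exists [:: w, u & v']; split => //.
- by move: av' => /= ->; rewrite xw.
- rewrite /= ; apply/andP; split => //.
  by apply: share1_edges => //; move: av' => /= /andP[].
- by rewrite walk_time_cons (walk_time_cons x w v) lerD2l.
Qed.

Lemma passage_time_ge0 x y p : path_from_to x y p -> 0 <= passage_time tau p.
Proof.
by move=> [[pe _] _]; rewrite /passage_time big_seq sumr_ge0// => e /pe/edge_time_ge0.
Qed.

Lemma point_time_le x y p : path_from_to x y p ->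
  point_time tau x y <= passage_time tau p.
Proof.
move=> xyp; apply: ge_inf; last by exists p.
by exists 0 => _ [q xyq <-]; exact: passage_time_ge0 xyq.
Qed.

(** Thanks to this, upper bounds on [point_time] may be proved with walks that backtrack. *)
Lemma path_of_walk x v : path adjacent x v ->
  exists p, path_from_to x (last x v) p /\ passage_time tau p <= walk_time x v.
Proof.
move=> /erase_backtracks[v' [av' lv' sv' tv']]; exists (edges x v'); split => //.
by split; [split => //; exact: walk_edges|exists v'].
Qed.

(** Comparison with every competitor replaces the infimum. Paths form a countable type, so this form
    also makes being a geodesic a measurable condition. *)
Lemma geodesicP x y p : path_from_to x y p ->
  geodesic tau x y p <->
  forall q, path_from_to x y q -> passage_time tau p <= passage_time tau q.
Proof.
move=> xyp; split => [[_ ->] q|pmin]; first exact: point_time_le.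
split => //; apply/eqP; rewrite eq_le point_time_le// andbT.
by apply: lb_le_inf; [exists (passage_time tau p), p|move=> _ [q xyq <-]; exact: pmin].
Qed.

Definition step (x : Zd) (ib : 'I_d * bool) : Zd :=
  x + (if ib.2 then 1 else -1) *: basis_vec ib.1.

(** Words over the finite alphabet of signed directions code the walks from [x]. *)
Lemma walk_steps x v : path adjacent x v ->
  exists s, size s = size v /\ v = scanl step x s.
Proof.
elim: v x => [|w v IH] x; first by exists [::].
move=> /= /andP[/adjacentP[i [s [wE s1]]] /IH[l [sl vE]]].
have stepE : step x (i, 0 < s) = w.
  by rewrite wE /step /=; congr (_ + _ *: _); case: ifP; lia.
exists ((i, 0 < s) :: l); split; first by rewrite /= sl.
by rewrite -[RHS]/(_ :: scanl step (step x (i, 0 < s)) l) stepE -vE.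
Qed.

(* The walks of bounded length from [x] form a finite type, and positive edge
   times bound the length of the paths to compare. *)
Lemma exists_geodesic (a : R) x y p0 : 0 < a ->
  (forall L, integer_lines L -> a <= tau L) ->
  path_from_to x y p0 -> exists p, geodesic tau x y p.
Proof.
move=> a0 atau xyp0.
have size_bound p : path_from_to x y p -> a * (size p)%:R <= passage_time tau p.
  move=> [[pe _] _]; rewrite -[size p]sum1_size natr_sum mulr_sumr /passage_time.
  rewrite big_seq [leRHS]big_seq; apply: ler_sum => e /pe/line_of_edgeP[eL _].
  by rewrite mulr1; exact: atau.
(* Each edge costs at least [a], so a path that takes no more time than [p0] has at most
   [passage_time tau p0 / a] edges. *)
pose S := (Num.trunc (passage_time tau p0 / a)).+1.
have short p : path_from_to x y p -> passage_time tau p <= passage_time tau p0 ->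
    (size p <= S)%N.
  move=> xyp pp0; have := le_trans (size_bound _ xyp) pp0.
  rewrite mulrC -ler_pdivlMr// => sp.
  by rewrite ltnW// -(ltr_nat R) (le_lt_trans sp)// truncnS_gt.
pose pathof (s : S.-bseq ('I_d * bool)) := edges x (scanl step x s).
have code p : path_from_to x y p -> (size p <= S)%N -> exists s, pathof s = p.
  move=> /path_from_to_walk[v [-> /walk_steps[s [ss vE]] _]].
  rewrite size_pairmap -ss => sS; exists (Bseq sS).
  by rewrite /pathof /= -vE.
have [s0 s0E] := code _ xyp0 (short _ xyp0 (lexx _)).
case: (@Order.TotalTheory.arg_minP _ R _ s0
  (fun s => `[< path_from_to x y (pathof s) >])
  (fun s => passage_time tau (pathof s))) => [|s /asboolP sxy smin].
  by apply/asboolP; rewrite s0E.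
exists (pathof s); apply/geodesicP => // q xyq.
(* A competitor at least as slow as [p0] loses to [p0], which has a code; a faster one is short
   enough to have a code itself. *)
have [|/ltW qp0] := lerP (passage_time tau p0) (passage_time tau q).
  by apply: le_trans; rewrite -s0E; apply: smin; apply/asboolP; rewrite s0E.
have [sq sqE] := code _ xyq (short _ xyq qp0).
by rewrite -sqE; apply: smin; apply/asboolP; rewrite sqE.
Qed.

End Times.
End Walks.

(** * Distance to the axis, height, and lower bounds on the time of a walk *)

Section Heights.
Local Set Implicit Arguments.
Local Unset Strict Implicit.
Local Unset Printing Implicit Defensive.
Context {d : nat}.
Variable i1 : 'I_d.
Notation Zd := 'rV[int]_d.
Implicit Types (x y u w z : Zd) (v : seq Zd).

Definition axis_proj z : Zd := z - z 0 i1 *: basis_vec i1.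

Definition axis_dist z : nat := l1norm (axis_proj z).

Lemma axis_projD z z' : axis_proj (z + z') = axis_proj z + axis_proj z'.
Proof. by rewrite /axis_proj mxE scalerDl opprD addrACA. Qed.

Lemma axis_dist0 : axis_dist 0 = 0%N.
Proof. by rewrite /axis_dist /axis_proj mxE scale0r subr0 l1norm0. Qed.

Lemma axis_distD z z' : (axis_dist (z + z') <= axis_dist z + axis_dist z')%N.
Proof. by rewrite /axis_dist axis_projD ler_l1normD. Qed.

Lemma l1norm_axis z : l1norm z = (`|z 0%R i1| + axis_dist z)%N.
Proof.
rewrite /axis_dist /axis_proj /l1norm (bigD1 i1)//= [in RHS](bigD1 i1)//=.
rewrite !mxE !eqxx mulr1 subrr add0n; congr addn; apply: eq_bigr => i ii1.
by rewrite !mxE (negbTE ii1) andbF mulr0 subr0.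
Qed.

Lemma axis_proj_line z : line (axis_proj z) i1 = line z i1.
Proof. by rewrite /axis_proj -scaleNr line_shift. Qed.

Lemma height_le x v (B : nat) : (forall u, u \in x :: v -> (axis_dist u <= B)%N) ->
  (height i1 (edges x v) <= B)%N.
Proof.
elim: v x => [|w v IH] x xvB; first by rewrite /height big_nil.
rewrite /height /= big_cons geq_max; apply/andP; split; last first.
  by apply: IH => u uv; apply: xvB; rewrite inE uv orbT.
apply/bigmax_leqP_seq => u; rewrite !inE => /orP[]/eqP-> _;
  by apply: xvB; rewrite !inE eqxx ?orbT.
Qed.

(** An empty walk has no edge, so its height is the empty maximum 0 and does not see the start;
    hence the start is taken on the axis. *)
Lemma axis_dist_le_height x v u : axis_dist x = 0%N -> u \in x :: v ->
  (axis_dist u <= height i1 (edges x v))%N.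
Proof.
have edge_le x' w u' : u' \in [fset x'; w]%fset ->
    (axis_dist u' <= \max_(y <- [fset x'; w]%fset) axis_dist y)%N.
  by move=> uxw; apply: (@leq_bigmax_seq _ _ xpredT axis_dist).
have tail x' v' : u \in v' -> (axis_dist u <= height i1 (edges x' v'))%N.
  elim: v' x' => // w v' IH x'; rewrite inE /height /= big_cons leq_max.
  move=> /orP[/eqP->|/IH->]; last by rewrite orbT.
  by rewrite edge_le// !inE eqxx orbT.
by move=> x0; rewrite inE => /orP[/eqP->|/tail//]; rewrite x0.
Qed.

Lemma walk_disp x v : path adjacent x v -> (l1norm (last x v - x) <= size v)%N.
Proof.
elim: v x => [|w v IH] x /=; first by rewrite subrr l1norm0.
move=> /andP[xw /IH vw]; rewrite -(subrK w (last w v)) -addrA.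
by rewrite (leq_trans (ler_l1normD _ _))// -[(size v).+1]addn1 leq_add// l1normBC (eqP xw).
Qed.

(** A step changes either the first coordinate or the transversal part, never both, so the two
    displacements compete for the same edges. With [x] the origin and [u] a highest vertex, this is
    the count of at least n + H edges. *)
Lemma size_walk_ge x v u : path adjacent x v -> u \in x :: v ->
  (`|((last x v - x) 0 i1)%R| + axis_dist (u - x) <= size v)%N.
Proof.
elim: v x => [|w v IH] x.
  by rewrite /= inE => _ /eqP->; rewrite subrr mxE axis_dist0.
move=> xv; have := xv => /= /andP[xw wv]; rewrite inE => /orP[/eqP->|uv].
  rewrite subrr axis_dist0 addn0 (leq_trans (leq_abs_l1norm _ _))//.
  exact: (walk_disp xv).
have {wv uv} := IH _ wv uv.
have : axis_dist (u - x) = axis_dist ((u - w) + (w - x)) by rewrite subrKA.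
have := axis_distD (u - w) (w - x).
have : last w v - x = (last w v - w) + (w - x) by rewrite subrKA.
move: xw; rewrite adjacentC /adjacent l1norm_axis => /eqP.
move=> wx -> du -> IHu; have -> z z' : (z + z') 0 i1 = z 0 i1 + z' 0 i1 by rewrite mxE.
by move: ((last w v - w) 0 i1) ((w - x) 0 i1) wx du IHu => s t; lia.
Qed.

Section Times.
Variables (R : realType) (tau : set Zd -> R).
Hypothesis tau_ge0 : forall L, integer_lines L -> 0 <= tau L.

Lemma walk_time_size (a : R) x v : (forall L, integer_lines L -> a <= tau L) ->
  path adjacent x v -> a * (size v)%:R <= walk_time tau x v.
Proof.
move=> atau; elim: v x => [|w v IH] x /=; first by rewrite walk_time_nil mulr0.
move=> /andP[xw wv]; rewrite walk_time_cons -addn1 natrD addrC mulrDr mulr1.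
apply: lerD (IH _ wv); apply: atau.
by have [] := line_of_edgeP (adjacent_is_edge xw).
Qed.

(* Each unit of displacement along the axis is paid for on an axial line
   through a vertex of the walk. *)
Lemma walk_time_axis (t : R) x v : 0 <= t -> path adjacent x v ->
  (forall u, u \in x :: v -> t <= tau (line u i1)) ->
  t * `|((last x v - x) 0 i1)%R|%N%:R <= walk_time tau x v.
Proof.
move=> t0; elim: v x => [|w v IH] x /=.
  by rewrite walk_time_nil subrr mxE mulr0.
move=> /andP[xw wv] tu; rewrite walk_time_cons.
have tx := tu x (mem_head _ _).
have {tu wv} IHw : t * `|((last w v - w) 0 i1)%R|%N%:R <= walk_time tau w v.
  by apply: IH => // u uv; apply: tu; rewrite inE uv orbT.
have [i [s [wE s1]]] := adjacentP xw.
have -> : last w v - x = (last w v - w) + (w - x) by rewrite subrKA.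
have wx : w - x = s *: basis_vec i by rewrite wE addrAC subrr add0r.
have [ii1|ii1] := eqVneq i i1; last first.
  rewrite wx mxE [X in _ + X]mxE basis_vecE eq_sym (negbTE ii1) mulr0 addr0.
  by apply: le_trans IHw _; rewrite lerDr edge_time_ge0//; exact: adjacent_is_edge.
rewrite /edge_time.
have -> : line_of_edge [fset x; w]%fset = line x i1 by rewrite wE line_of_step// ii1.
apply: le_trans (lerD tx IHw); rewrite -{2}(mulr1 t) -mulrDr ler_wpM2l//.
rewrite -(natrD R 1) ler_nat wx mxE [X in _ + X]mxE basis_vecE ii1 eqxx mulr1.
by move: ((last w v - w) 0 i1) => r; lia.
Qed.

(** Time bounds are stated on walks rather than paths, so that they add up under concatenation. *)
Definition reach x y (C : R) :=
  exists v, [/\ path adjacent x v, last x v = y & walk_time tau x v <= C].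

Lemma reach_refl x : reach x x 0.
Proof. by exists [::]; split => //; rewrite walk_time_nil. Qed.

Lemma reach_trans x y z C D : reach x y C -> reach y z D -> reach x z (C + D).
Proof.
move=> [v [xv vy tv]] [u [yu uz tu]]; exists (v ++ u); split.
- by rewrite cat_path xv vy.
- by rewrite last_cat vy.
- by rewrite walk_time_cat vy lerD.
Qed.

Lemma reach_le x y C D : C <= D -> reach x y C -> reach x y D.
Proof. by move=> CD [v [xv vy tv]]; exists v; split => //; exact: le_trans tv CD. Qed.

(** The sign [s] allows the line to be traversed in both directions. *)
Lemma reach_line x i (s : int) (k : nat) (t : R) : `|s|%N = 1%N ->
  tau (line x i) <= t -> reach x (x + (k%:Z * s) *: basis_vec i) (k%:R * t).
Proof.
move=> s1 xt; elim: k => [|k IH].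
  by rewrite !mul0r scale0r addr0; exact: reach_refl.
rewrite -[k.+1]addn1 natrD PoszD !mulrDl !mul1r scalerDl addrA.
apply: reach_trans IH _; set y := _ + _.
exists [:: y + s *: basis_vec i]; split => //=.
  by rewrite adjacent_basis.
rewrite walk_time_cons walk_time_nil addr0 /edge_time line_of_step//.
by rewrite /y line_shift.
Qed.

End Times.
End Heights.

(** * Axial lines and the route that follows one of them *)

Section Transversal.
Local Set Implicit Arguments.
Local Unset Strict Implicit.
Local Unset Printing Implicit Defensive.
Context {d' : nat}.
Notation d := d'.+1.
Notation Zd := 'rV[int]_d.
Notation e1 := (@basis_vec d ord0).
Implicit Types (u x z : Zd) (v : seq Zd) (y : 'I_d' -> nat).

(** An axial line meets the hyperplane of first coordinate 0 in exactly one point, so these points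
    parametrize the axial lines. *)
Definition transversal (f : 'I_d' -> int) : Zd :=
  \row_j (if unlift ord0 j is Some k then f k else 0).

Lemma transversal_lift f k : transversal f 0 (lift ord0 k) = f k.
Proof. by rewrite mxE liftK. Qed.

Lemma transversal0 f : transversal f 0 ord0 = 0.
Proof. by rewrite mxE unlift_none. Qed.

Lemma axial_line_inj f g :
  line (transversal f) ord0 = line (transversal g) ord0 -> f =1 g.
Proof.
move=> fg k.
have : line (transversal f) ord0 (transversal f) by exists 0 => //; rewrite scale0r addr0.
rewrite fg => -[s _ /rowP/(_ (lift ord0 k))].
by rewrite mxE !transversal_lift !mxE /= mulr0 addr0.
Qed.

(** This separates connecting lines from axial ones, which makes their passage times independent. *)
Lemma axial_line_neq x z k : line x (lift ord0 k) <> line z ord0.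
Proof.
move=> xz.
have [s _] : line z ord0 x by rewrite -xz; exists 0 => //; rewrite scale0r addr0.
have [t _] : line z ord0 (x + basis_vec (lift ord0 k)).
  by rewrite -xz; exists 1 => //; rewrite scale1r.
move=> /rowP/(_ (lift ord0 k)) + /rowP/(_ (lift ord0 k)).
by rewrite !mxE !eqxx /= !mulr0 !addr0; lia.
Qed.

(** The transversal coordinates lie between [-B] and [B]; shifting them by [B] gives a finite index
    set, of cardinality [B.*2.+1 ^ d'], for the union bound. *)
Lemma axial_line_box u (B : nat) : (axis_dist ord0 u <= B)%N ->
  exists y : {ffun 'I_d' -> 'I_(B.*2.+1)},
    line u ord0 = line (transversal (fun k => (y k)%:Z - B%:Z)) ord0.
Proof.
move=> uB.
have ub k : (`|(u 0 (lift ord0 k))%R| <= B)%N.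
  apply: leq_trans uB; apply: leq_trans (leq_abs_l1norm _ (lift ord0 k)).
  by rewrite /axis_proj !mxE /= mulr0 subr0.
exists [ffun k => inord `|(u 0 (lift ord0 k) + B%:Z)%R|%N].
rewrite -axis_proj_line; congr (line _ _); apply/rowP => j.
have [k ->|->] := unliftP ord0 j; last first.
  by rewrite transversal0 !mxE !eqxx mulr1 subrr.
have uk := ub k.
rewrite transversal_lift ffunE inordK; last by lia.
rewrite !mxE /= mulr0 subr0; lia.
Qed.

(** These are the corners of a staircase from the origin to [y] that adjusts one coordinate at a
    time. *)
Definition truncate (y : 'I_d' -> nat) (k : nat) (i : 'I_d') : int :=
  if (i < k)%N then (y i)%:Z else 0.

Lemma transversal_truncate0 y : transversal (truncate y 0) = 0.
Proof.
by apply/rowP => j; have [k ->|->] := unliftP ord0 j;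
  rewrite ?transversal_lift ?transversal0 mxE.
Qed.

Lemma transversal_truncate_full y :
  transversal (truncate y d') = transversal (fun k => (y k)%:Z).
Proof.
by apply/rowP => j; have [k ->|->] := unliftP ord0 j;
  rewrite ?transversal_lift ?transversal0// /truncate ltn_ord.
Qed.

Lemma transversal_truncateS y (k : 'I_d') : transversal (truncate y k.+1) =
  transversal (truncate y k) + (y k)%:Z *: basis_vec (lift ord0 k).
Proof.
have entry z (c : int) i j : (z + c *: basis_vec i) 0 j = z 0 j + c * (j == i)%:R.
  by rewrite !mxE.
apply/rowP => j; rewrite entry.
have [i ->|->] := unliftP ord0 j; last by rewrite !transversal0 /= mulr0 addr0.
rewrite !transversal_lift (inj_eq (@lift_inj _ ord0)) /truncate ltnS leq_eqVlt.
have [->|ik] := eqVneq i k; first by rewrite !eqxx ltnn mulr1 add0r.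
by rewrite (negbTE ik : (val i == val k) = false) mulr0 addr0.
Qed.

Section Times.
Variables (R : realType) (tau : set Zd -> R).
Hypothesis tau_ge0 : forall L, integer_lines L -> 0 <= tau L.

(** The staircase uses [d'] lines, each for at most [m] edges. Both directions are needed: out to
    the axial line near 0, and back to the axis near [n%:Z *: e1]. *)
Lemma reach_transversal (b : Zd) (y : 'I_d' -> nat) (m : nat) (M : R) :
  0 <= M -> (forall k, (y k <= m)%N) ->
  (forall k : 'I_d', tau (line (b + transversal (truncate y k)) (lift ord0 k)) <= M) ->
  let z := b + transversal (fun k => (y k)%:Z) in
  reach tau b z (d'%:R * (m%:R * M)) /\ reach tau z b (d'%:R * (m%:R * M)).
Proof.
move=> M0 ym tauM; rewrite /= -transversal_truncate_full.
suff chain k : (k <= d')%N -> let x := b + transversal (truncate y k) in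
    reach tau b x (k%:R * (m%:R * M)) /\ reach tau x b (k%:R * (m%:R * M)).
  exact: chain.
elim: k => [|k IH] kd /=.
  by rewrite transversal_truncate0 addr0 mul0r; split; exact: reach_refl.
have [IH1 IH2] := IH (ltnW kd); pose k' := Ordinal kd.
have -> : k.+1%:R * (m%:R * M) = k%:R * (m%:R * M) + m%:R * M.
  by rewrite -[k.+1]addn1 natrD mulrDl mul1r.
have yk : (y k')%:R * M <= m%:R * M by rewrite ler_wpM2r// ler_nat.
rewrite (transversal_truncateS y k') addrA; split.
  apply: reach_trans IH1 _; apply: reach_le yk _.
  by rewrite -[(y k')%:Z]mulr1; apply: reach_line => //; exact: (tauM k').
rewrite [X in reach _ _ _ X]addrC; apply: reach_trans _ IH2; apply: reach_le yk _.
(* The return leg starts at the far end of the same line and follows it with sign -1. *)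
set x := b + _; rewrite -{2}(addrK ((y k')%:Z *: basis_vec (lift ord0 k')) x).
rewrite -scaleNr -[- (y k')%:Z]mulrN1; apply: reach_line => //.
by rewrite line_shift; exact: (tauM k').
Qed.

(** The route goes up a staircase at 0, along [n] edges of the axial line, and down a staircase at
    [n%:Z *: e1]. *)
Lemma reach_axis (n m : nat) (y : 'I_d' -> nat) (t M : R) :
  0 <= M -> (forall k, (y k <= m)%N) ->
  (forall k : 'I_d', tau (line (transversal (truncate y k)) (lift ord0 k)) <= M) ->
  (forall k : 'I_d',
    tau (line (n%:Z *: e1 + transversal (truncate y k)) (lift ord0 k)) <= M) ->
  tau (line (transversal (fun k => (y k)%:Z)) ord0) <= t ->
  reach tau 0 (n%:Z *: e1) (n%:R * t + 2 * d'%:R * m%:R * M).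
Proof.
move=> M0 ym up down yt.
have [|up1 _] := @reach_transversal 0 y m M M0 ym.
  by move=> k; rewrite add0r.
have [_ down1] := @reach_transversal (n%:Z *: e1) y m M M0 ym down.
have -> : n%:R * t + 2 * d'%:R * m%:R * M =
    d'%:R * (m%:R * M) + (n%:R * t + d'%:R * (m%:R * M)) by lra.
apply: reach_trans up1 (reach_trans _ down1); rewrite add0r addrC.
by rewrite -[n%:Z]mulr1; exact: reach_line.
Qed.

(** Staying within height [B] would cost at least [t] for each of [n] axial advances, more than the
    available [C]. In the other direction, every edge costs at least [a] and a geodesic has at least
    [n] plus its height of them. *)
Lemma geodesic_heights (n B : nat) (a t C : R) : 0 < a ->
  (forall L, integer_lines L -> a <= tau L) ->
  reach tau 0 (n%:Z *: e1) C ->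
  (forall u, (axis_dist ord0 u <= B)%N -> t <= tau (line u ord0)) ->
  0 <= t -> C < n%:R * t ->
  (exists p, geodesic tau 0 (n%:Z *: e1) p) /\
  forall p, geodesic tau 0 (n%:Z *: e1) p ->
    (B < height ord0 p)%N /\ a * (n + height ord0 p)%N%:R <= C.
Proof.
move=> a0 atau [v [wv vn vC]] tB t0 Cnt.
have [p0 [p0n p0C]] := path_of_walk tau_ge0 wv; rewrite vn in p0n.
split; first exact: exists_geodesic tau_ge0 _ _ _ _ a0 atau p0n.
move=> p [/path_from_to_walk[v' [-> {}wv {}vn]] pT].
have {}vC : walk_time tau 0 v' <= C.
  by rewrite /walk_time pT (le_trans (point_time_le tau_ge0 p0n))// (le_trans p0C).
have n1 : `|((last 0 v' - 0) 0 ord0)%R|%N = n.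
  by rewrite vn subr0 !mxE !eqxx mulr1.
split.
  rewrite ltnNge; apply: contraTN Cnt => hB; rewrite -leNgt.
  apply: le_trans vC; rewrite -{1}n1 mulrC; apply: walk_time_axis => // u uv.
  by apply: tB; apply: leq_trans hB; apply: axis_dist_le_height; rewrite ?axis_dist0.
apply: le_trans vC; apply: le_trans (walk_time_size atau wv).
rewrite ler_pM2l// ler_nat -{1}n1.
(* The natural subtraction is not truncated: the axial displacement is at most the number of
   edges. *)
suff hv : (height ord0 (edges 0 v') <= size v' - `|((last 0 v' - 0) 0 ord0)%R|)%N.
  rewrite -leq_subRL//; apply: leq_trans (walk_disp wv).
  exact: leq_abs_l1norm.
apply: height_le => u uv; rewrite leq_subRL.
  by have := size_walk_ge ord0 wv uv; rewrite [u - 0]subr0.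
apply: leq_trans (walk_disp wv); exact: leq_abs_l1norm.
Qed.

End Times.
End Transversal.

(** * Measurability of the events on the maximal height *)

Section Measurability.
Local Set Implicit Arguments.
Local Unset Strict Implicit.
Local Unset Printing Implicit Defensive.
Context {dT : measure_display} {T : measurableType dT}.

Lemma measurable_forall (I : countType) (A : I -> T -> Prop) :
  (forall i, measurable [set w | A i w]) -> measurable [set w | forall i, A i w].
Proof.
move=> mA; rewrite (_ : [set w | _] = ~` \bigcup_i ~` [set w | A i w]).
  apply: measurableC; apply: countable_bigcupT_measurable => [|i].
    exact: countableP.
  exact/measurableC/mA.
by rewrite setC_bigcup; apply/seteqP; split => w /= wA i;
  [move=> _; rewrite setCK; exact: wA|move: (wA i Logic.I); rewrite setCK].
Qed.

Lemma measurable_imply (Q : Prop) (A : T -> Prop) :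
  measurable [set w | A w] -> measurable [set w | Q -> A w].
Proof.
move=> mA; have [q|nq] := pselect Q.
  by rewrite (_ : [set w | _] = [set w | A w])//; apply/seteqP; split => w /=; tauto.
by rewrite (_ : [set w | _] = setT)//; apply/seteqP; split => w /=; tauto.
Qed.

Lemma measurable_exists (I : countType) (A : I -> set T) :
  (forall i, measurable (A i)) -> measurable [set w | exists i, A i w].
Proof.
move=> mA; rewrite (_ : [set w | _] = \bigcup_i A i).
  by apply: countable_bigcupT_measurable => //; exact: countableP.
by apply/seteqP; split => w; [move=> [i ?]; exists i|move=> [i _ ?]; exists i].
Qed.

Context {R : realType} (P : probability T R) {d : nat}.
Variables (tau : set 'rV[int]_d -> {RV P >-> R}).
Hypothesis tau_ge0 : forall L, integer_lines L -> forall w, 0 <= tau L w.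
Notation time w := (fun L => tau L w).

Lemma measurable_passage_time p : measurable_fun setT (fun w => passage_time (time w) p).
Proof.
rewrite /passage_time; apply: measurable_sum => e.
exact: measurable_funPT.
Qed.

(** The event says that no path higher than [b] is a geodesic, which by [geodesicP] involves
    countably many comparisons of passage times. *)
Lemma measurable_max_height_le i n (b : R) :
  measurable [set w | (max_height (time w) i n <= b%:E)%E].
Proof.
have -> : [set w | (max_height (time w) i n <= b%:E)%E] =
    [set w | forall p, path_from_to 0 (n%:Z *: basis_vec i) p ->
      ~ ((height i p)%:R <= b) ->
      ~ forall q, path_from_to 0 (n%:Z *: basis_vec i) q ->
        passage_time (time w) p <= passage_time (time w) q].
  have tw w : forall L, integer_lines L -> 0 <= tau L w by move=> L /tau_ge0.
  apply/seteqP; split => w /= wb.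
    move=> p np hb /(geodesicP (tw w) np) geo; apply: hb.
    rewrite -lee_fin; apply: le_trans wb; apply: ereal_sup_ubound.
    by exists p.
  apply: ge_ereal_sup => _ [p geo <-]; rewrite lee_fin.
  have [//|hb] := pselect ((height i p)%:R <= b).
  have [np _] := geo; exfalso; apply: (wb p np hb).
  exact/(geodesicP (tw w) np).
apply: measurable_forall => p; do 2! apply: measurable_imply.
apply: (@measurableC _ _ [set w | forall q, _]).
apply: measurable_forall => q; apply: measurable_imply.
rewrite -[X in measurable X]setTI.
exact: measurable_fun_le (measurable_passage_time p) (measurable_passage_time q).
Qed.

Lemma measurable_max_height i n (l b : R) :
  measurable [set w | (l%:E <= max_height (time w) i n <= b%:E)%E].
Proof.
have -> : [set w | (l%:E <= max_height (time w) i n <= b%:E)%E] =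
    [set w | (max_height (time w) i n <= b%:E)%E] `&`
    (* Being below [l] means being at most [l - k.+1%:R^-1] for some [k], which reduces the lower
       bound to events of the previous kind. *)
    [set w | forall k : nat, ~ (max_height (time w) i n <= (l - k.+1%:R^-1)%:E)%E].
  apply/seteqP; split => w /=.
    move=> /andP[lw wb]; split => // k wk; have := le_trans lw wk.
    by rewrite lee_fin lerBrDr gerDl invr_le0 lern0.
  move=> [wb wl]; rewrite wb andbT leNgt; apply/negP => wl'.
  (* Without any geodesic the supremum is [-oo], which [k = 0] excludes. *)
  case: (max_height _ _ _) wl wl' => [r|//|] wl; last by have := wl 0%N; rewrite leNye.
  rewrite lte_fin => rl.
  have [k rkl] := ltr_add_invr rl.
  by apply: (wl k); rewrite lee_fin lerBrDr ltW.
apply: measurableI; first exact: measurable_max_height_le.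
apply: measurable_forall => k.
apply: (@measurableC _ _ [set w | (max_height (time w) i n <= _)%E]).
exact: measurable_max_height_le.
Qed.

End Measurability.

(** * Independent passage times and the first fast line in an enumeration *)

Section FirstSuccess.
Local Set Implicit Arguments.
Local Unset Strict Implicit.
Local Unset Printing Implicit Defensive.
Context {dT : measure_display} {T : measurableType dT} {R : realType}.
Variables (P : probability T R) (I : choiceType) (D : set I).
Variables (X : I -> {RV P >-> R}) (F : R -> R).
Hypothesis X_iid : iid_with_cdf D X F.

Lemma measurable_le (t : R) : measurable [set x : R | x <= t].
Proof.
rewrite (_ : [set x | _] = [set` `]-oo, t]]); first exact: measurable_itv.
by apply/seteqP; split => x /=; rewrite in_itv.
Qed.

Lemma measurable_gt (t : R) : measurable [set x : R | t < x].
Proof.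
rewrite (_ : [set x | _] = [set` `]t, +oo[]); first exact: measurable_itv.
by apply/seteqP; split => x /=; rewrite in_itv/= andbT.
Qed.

Lemma measurable_rv_le i t : measurable [set w | X i w <= t].
Proof. exact: (measurable_funPTI (X i) (measurable_le t)). Qed.

Lemma measurable_rv_gt i t : measurable [set w | t < X i w].
Proof. exact: (measurable_funPTI (X i) (measurable_gt t)). Qed.

Lemma prob_le i t : D i -> P [set w | X i w <= t] = (F t)%:E.
Proof.
by move=> Di; rewrite -(X_iid.2 i Di t); congr (P _).
Qed.

Lemma prob_gt i t : D i -> P [set w | t < X i w] = (1 - F t)%:E.
Proof.
move=> Di; rewrite EFinB -(prob_le t Di) -probability_setC; last exact: measurable_rv_le.
by congr (P _); apply/seteqP; split => w /=; rewrite ltNge => /negP.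
Qed.

Lemma cdf_ge0_le1 i t : D i -> 0 <= F t <= 1.
Proof.
move=> Di; have P0 A : (0 <= P A)%E by exact: measure_ge0.
rewrite -lee_fin -(prob_le t Di) P0 /= -subr_ge0 -lee_fin -(prob_gt t Di).
exact: P0.
Qed.

Lemma independent_seq (s : seq I) (B : I -> set R) : uniq s ->
  (forall i, i \in s -> D i) -> (forall i, measurable (B i)) ->
  P [set w | forall i, i \in s -> B i (X i w)] =
  (\prod_(i <- s) P (X i @^-1` B i))%E.
Proof.
move=> us sD mB.
have [ind _] := X_iid; have := ind [fset i in s]%fset B _ mB.
have -> : \bigcap_(i in [set` [fset i in s]%fset]) X i @^-1` B i =
    [set w | forall i, i \in s -> B i (X i w)].
  by apply/seteqP; split => w /= wB i; have := wB i; rewrite /= !inE.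
move=> ->; last by move=> i /=; rewrite !inE; exact: sD.
apply: perm_big; apply: uniq_perm => // i.
by rewrite !inE.
Qed.

Lemma prob_all_gt (L : nat -> I) (N : nat) (t : R) :
  (forall k, D (L k)) -> {in gtn N &, injective L} ->
  P [set w | forall k, (k < N)%N -> t < X (L k) w] = ((1 - F t) ^+ N)%:E.
Proof.
move=> DL injL.
have -> : [set w | forall k, (k < N)%N -> t < X (L k) w] =
    [set w | forall i, i \in map L (iota 0 N) -> [set x | t < x] (X i w)].
  apply/seteqP; split => w /= wt.
    by move=> i /mapP[k]; rewrite mem_iota => /wt kt ->.
  by move=> k kN; apply: wt; apply: map_f; rewrite mem_iota.
rewrite (independent_seq (B := fun=> [set x | t < x])).
- rewrite big_map (eq_bigr (fun=> (1 - F t)%:E)) => [|k _]; last exact: prob_gt.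
  by rewrite prodEFin -[in LHS](subn0 N) -/(index_iota 0 N) big_const_nat subn0 iter_mulr_1.
- by rewrite map_inj_in_uniq ?iota_uniq// => i j; rewrite !mem_iota; exact: injL.
- by move=> i /mapP[k _ ->].
- by move=> _; exact: measurable_gt.
Qed.

(** [L] lists the candidates, and [l k] is a line to be used if candidate [k] is the one chosen. *)
Definition first_success_bad (L l : nat -> I) (t M : R) (k : nat) : set T :=
  [set w | [/\ forall j, (j < k)%N -> t < X (L j) w, X (L k) w <= t & M < X (l k) w]].

Lemma measurable_first_success_bad L l t M k : measurable (first_success_bad L l t M k).
Proof.
have -> : first_success_bad L l t M k = [set w | forall j, (j < k)%N -> t < X (L j) w] `&`
    ([set w | X (L k) w <= t] `&` [set w | M < X (l k) w]).
  by apply/seteqP; split => w [? []].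
apply: measurableI; last exact: measurableI (measurable_rv_le _ _) (measurable_rv_gt _ _).
apply: measurable_forall => j; apply: measurable_imply; exact: measurable_rv_gt.
Qed.

(** For fixed [k] the event constrains [k + 2] distinct lines separately, so it factorizes. A single
    connecting line enters, so distinct candidates may share theirs. *)
Lemma prob_first_success_bad (L l : nat -> I) (k : nat) (t M : R) :
  (forall j, D (L j)) -> {in gtn k.+1 &, injective L} ->
  D (l k) -> (forall j, l k <> L j) ->
  P (first_success_bad L l t M k) = ((1 - F t) ^+ k * F t * (1 - F M))%:E.
Proof.
move=> DL injL Dl lL.
(* Independence wants one set per index, so the three constraints are told apart by the index; the
   last branch serves the failures before [k]. *)
pose B i := if i == l k then [set x | M < x] else
            if i == L k then [set x | x <= t] else [set x : R | t < x].
have BL j : (j < k)%N -> B (L j) = [set x | t < x].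
  move=> jk; rewrite /B eq_sym; case: eqP => [/lL//|_]; case: eqP => // /injL.
  by rewrite !inE => /(_ (ltnW jk) (ltnSn k)) jkE; rewrite jkE ltnn in jk.
have BLk : B (L k) = [set x | x <= t].
  by rewrite /B eq_sym; case: eqP => [/lL//|_]; rewrite eqxx.
have Blk : B (l k) = [set x | M < x] by rewrite /B eqxx.
have mB i : measurable (B i).
  rewrite /B; case: ifP => _; [|case: ifP => _].
  - exact: measurable_gt.
  - exact: measurable_le.
  - exact: measurable_gt.
have -> : first_success_bad L l t M k =
    [set w | forall i, i \in l k :: L k :: map L (iota 0 k) -> B i (X i w)].
  apply/seteqP; split => w /=.
    move=> [wt wk wM] i; rewrite !inE => /orP[/eqP->|/orP[/eqP->|/mapP[j]]].
    - by rewrite Blk.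
    - by rewrite BLk.
    - by rewrite mem_iota => jk ->; rewrite BL//; exact: wt.
  move=> wB; split.
  - move=> j jk; have := wB (L j); rewrite BL//; apply.
    by rewrite !inE map_f ?orbT// mem_iota.
  - by have := wB (L k); rewrite BLk; apply; rewrite !inE eqxx orbT.
  - by have := wB (l k); rewrite Blk; apply; rewrite !inE eqxx.
rewrite independent_seq//; last 2 first.
- rewrite /= !inE negb_or -!andbA; apply/and4P; split.
  + exact/eqP.
  + by apply/mapP => -[j _ /lL].
  + apply/mapP => -[j]; rewrite mem_iota => /= jk /esym/injL; rewrite !inE.
    by move=> /(_ (ltnW jk) (ltnSn k)) jkE; rewrite jkE ltnn in jk.
  + rewrite map_inj_in_uniq ?iota_uniq// => i j; rewrite !mem_iota /= => ik jk.
    by apply: injL; rewrite inE ltnW.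
- by move=> i; rewrite !inE => /orP[/eqP->|/orP[/eqP->|/mapP[j _ ->]]].
rewrite !big_cons big_map Blk BLk (prob_gt M Dl) (prob_le t (DL k)).
rewrite (_ : (\prod_(j <- iota 0 k) _)%E = ((1 - F t) ^+ k)%:E).
  by rewrite -!EFinM; congr (_%:E); lra.
have -> : (\prod_(j <- iota 0 k) P (X (L j) @^-1` B (L j)) =
    \prod_(j <- iota 0 k) (1 - F t)%:E)%E.
  apply: eq_big_seq => j; rewrite mem_iota => /BL ->; exact: prob_gt.
by rewrite prodEFin -[in LHS](subn0 k) -/(index_iota 0 k) big_const_nat subn0 iter_mulr_1.
Qed.

(* Independence of [X (l k)] from the event that [L k] is the first success
   makes the choice of the random index harmless. *)
Lemma prob_exists_first_success_bad (L l : nat -> I) (N : nat) (t M : R) :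
  (forall j, D (L j)) -> {in gtn N &, injective L} ->
  (forall j, D (l j)) -> (forall i j, l i <> L j) ->
  (P (\big[setU/set0]_(k < N) first_success_bad L l t M k) <= (1 - F M)%:E)%E.
Proof.
move=> DL injL Dl lL; have mA k := measurable_first_success_bad L l t M k.
apply: (le_trans (Boole_inequality P (fun i _ => mA i))).
rewrite (eq_bigr (fun k : 'I_N => ((1 - F t) ^+ k * F t * (1 - F M))%:E)); last first.
  move=> k _; apply: prob_first_success_bad => // i j; rewrite !inE => ik jk.
  by apply: injL; rewrite inE (leq_trans ik, leq_trans jk).
rewrite sumEFin lee_fin -mulr_suml.
have /andP[Ft0 Ft1] := cdf_ge0_le1 t (DL 0%N).
have /andP[FM0 FM1] := cdf_ge0_le1 M (DL 0%N).
rewrite -{2}[1 - F M]mul1r ler_wpM2r ?subr_ge0//.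
(* The geometric sum equals [1 - (1 - F t) ^+ N], the probability of at least one success, hence is
   at most 1. *)
rewrite -mulr_suml; have : 0 <= (1 - F t) ^+ N by rewrite exprn_ge0// subr_ge0.
have := subrX1 (1 - F t) N; set S := \sum_(_ < N) _; nra.
Qed.

End FirstSuccess.

(** * Probability bound for the height at fixed scales *)

Section HeightProbability.
Local Set Implicit Arguments.
Local Unset Strict Implicit.
Local Unset Printing Implicit Defensive.
Context {dT : measure_display} {T : measurableType dT} {R : realType}.
Variable P : probability T R.

Lemma prob_exists_le (J : finType) (A : J -> set T) (r : R) :
  (forall j, measurable (A j)) -> (forall j, (P (A j) <= r%:E)%E) ->
  (P [set w | exists j, A j w] <= (#|J|%:R * r)%:E)%E.
Proof.
move=> mA Ar.
have -> : [set w | exists j, A j w] = \big[setU/set0]_(j <- enum J) A j.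
  rewrite -bigcup_seq; apply/seteqP; split => w.
    by move=> [j ?]; exists j => //=; rewrite mem_enum.
  by move=> [j _ ?]; exists j.
rewrite cardE; elim: (enum J) => [|j s IH]; first by rewrite big_nil measure0 mul0r.
rewrite big_cons (le_trans (measureU2 _ _ _))//; first exact: bigsetU_measurable.
by rewrite /= -[(size s).+1]addn1 natrD mulrDl mul1r addrC EFinD leeD.
Qed.

Lemma prob_exists_null (I : countType) (A : I -> set T) :
  (forall i, measurable (A i)) -> (forall i, P (A i) = 0) ->
  P [set w | exists i, A i w] = 0.
Proof.
move=> mA A0; apply/eqP; rewrite eq_le measure_ge0 andbT.
pose G n := if choice.unpickle n is Some i then A i else set0.
have mG n : measurable (G n) by rewrite /G; case: choice.unpickle.
apply: le_trans (_ : (\sum_(0 <= n <oo) P (G n) <= _)%E).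
  apply: measure_sigma_subadditive => //; first exact: measurable_exists.
  by move=> w [i Aiw]; exists (choice.pickle i) => //; rewrite /G choice.pickleK.
by rewrite eseries0// => n _ _; rewrite /G; case: choice.unpickle => [i|]; rewrite ?A0 ?measure0.
Qed.

Context {d' : nat}.
Notation d := d'.+1.
Notation Zd := 'rV[int]_d.
Notation e1 := (@basis_vec d ord0).
Variables (tau : set Zd -> {RV P >-> R}) (F : R -> R) (a : R).
Hypothesis tau_iid : iid_with_cdf (@integer_lines d) tau F.
Hypothesis tau_ge0 : forall L, integer_lines L -> forall w, 0 <= tau L w.
Hypothesis Fa : is_support_inf F a.
Hypothesis a0 : 0 < a.

(** Indexing lines by a point and a direction makes the union countable. The gaps [xin.2.+1%:R^-1]
    are there because the support condition controls [F] only at points strictly below [a]. *)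
Definition below_support : set T :=
  [set w | exists xin : Zd * 'I_d * nat,
    tau (line xin.1.1 xin.1.2) w <= a - xin.2.+1%:R^-1].

Lemma measurable_below_support : measurable below_support.
Proof. by apply: measurable_exists => xin; exact: measurable_rv_le. Qed.

Lemma prob_below_support : P below_support = 0.
Proof.
apply: prob_exists_null => [xin|[[x i] n]]; first exact: measurable_rv_le.
rewrite (prob_le tau_iid)/=; last exact: integer_line.
have n0 : 0 < n.+1%:R^-1 :> R by rewrite invr_gt0.
by have [_ ->] := Fa n0.
Qed.

Lemma above_support w : ~ below_support w -> forall L, integer_lines L -> a <= tau L w.
Proof.
move=> nw L [x [i ->]]; rewrite leNgt; apply/negP => ta; apply: nw.
have [k tk] := ltr_add_invr ta; exists (x, i, k) => /=.
by rewrite lerBrDr ltW.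
Qed.

Section FixedScales.
Variables (n m B : nat) (t1 t2 M : R).
Notation N := (m.+1 ^ d')%N.

(** Past the last point of the box the enumeration returns the origin; the events below only look at
    [k < N]. *)
Definition box_point (k : nat) : {ffun 'I_d' -> 'I_m.+1} := 
  nth [ffun=> ord0] (enum {: {ffun 'I_d' -> 'I_m.+1}}) k.

Definition axial k : set Zd := line (transversal (fun i => (box_point k i)%:Z)) ord0.

(** [jb.1] is the coordinate adjusted by this stair, and [jb.2] tells whether the staircase stands
    at [n%:Z *: e1] or at 0. *)
Definition connector (jb : 'I_d' * bool) k : set Zd :=
  line ((if jb.2 then n%:Z else 0) *: e1 +
        transversal (truncate (fun i => box_point k i) jb.1)) (lift ord0 jb.1).

Lemma axial_inj : {in gtn N &, injective axial}.
Proof.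
move=> i j; rewrite !inE => iN jN /axial_line_inj ij.
have card : size (enum {: {ffun 'I_d' -> 'I_m.+1}}) = N.
  by rewrite -cardE card_ffun !card_ord.
apply/eqP; rewrite -(@nth_uniq _ [ffun=> ord0] (enum {: {ffun 'I_d' -> 'I_m.+1}})).
- by apply/eqP/ffunP => k; apply: val_inj; have [] := ij k.
- by rewrite card.
- by rewrite card.
- exact: enum_uniq.
Qed.

Definition no_fast_line : set T :=
  [set w | forall k, (k < N)%N -> t1 < tau (axial k) w].

Definition bad_connector jb : set T :=
  \big[setU/set0]_(k < N) first_success_bad tau axial (connector jb) t1 M k.

Definition fast_low_line : set T :=
  [set w | exists y : {ffun 'I_d' -> 'I_(B.*2.+1)},
    tau (line (transversal (fun k => (y k)%:Z - B%:Z)) ord0) w <= t2].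

(** The route takes the least fast index [k]: a slow connector at that [k] is exactly an instance of
    [bad_connector]. *)
Lemma reach_fast w : 0 <= M -> ~ no_fast_line w -> (forall jb, ~ bad_connector jb w) ->
  reach (fun L => tau L w) 0 (n%:Z *: e1) (n%:R * t1 + 2 * d'%:R * m%:R * M).
Proof.
move=> M0 fast good.
have [k [kN kt kmin]] : exists k, [/\ (k < N)%N, tau (axial k) w <= t1 &
    forall j, (j < k)%N -> t1 < tau (axial j) w].
  have ex : exists k, (k < N)%N && (tau (axial k) w <= t1).
    apply: contrapT => nex; apply: fast => k kN; rewrite ltNge; apply/negP => kt.
    by apply: nex; exists k; rewrite kN.
  exists (ex_minn ex); case: ex_minnP => k /andP[kN kt] kmin; split => // j jk.
  rewrite ltNge; apply/negP => jt; have := kmin j.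
  by rewrite (ltn_trans jk kN) jt leqNgt jk => /(_ isT).
have conn jb : tau (connector jb k) w <= M.
  rewrite leNgt; apply/negP => tM; apply: (good jb); rewrite /bad_connector -bigcup_mkord.
  by exists k.
apply: (@reach_axis _ _ _ n m (fun i => box_point k i)) => //.
- by move=> i; rewrite -ltnS.
- by move=> j; have := conn (j, false); rewrite /connector /= scale0r add0r.
- by move=> j; exact: (conn (j, true)).
Qed.

(** Up to the null event [below_support], the three error terms account for the absence of a fast
    line in the box, a slow connector, and a line of time at most [t2] within distance [B] of the
    axis. Off these events [geodesic_heights] applies. *)
Lemma prob_height_ge (l b : R) : 0 <= M -> 0 <= t2 ->
  n%:R * t1 + 2 * d'%:R * m%:R * M < n%:R * t2 ->
  l <= B.+1%:R ->
  (forall k : nat, a * (n + k)%N%:R <= n%:R * t1 + 2 * d'%:R * m%:R * M -> k%:R <= b) ->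
  ((1 - ((1 - F t1) ^+ N + 2 * d'%:R * (1 - F M) + (B.*2.+1 ^ d')%N%:R * F t2))%:E
    <= P [set w | (l%:E <= max_height (fun L => tau L w) ord0 n <= b%:E)%E])%E.
Proof.
move=> M0 t20 t12 lB bP; set G := [set w | _].
have mG : measurable G by exact: measurable_max_height.
have mbad jb : measurable (bad_connector jb).
  by apply: bigsetU_measurable => k _; exact: measurable_first_success_bad.
have mno : measurable no_fast_line.
  apply: measurable_forall => k; apply: measurable_imply; exact: measurable_rv_gt.
have mlow : measurable fast_low_line.
  by apply: measurable_exists => y; exact: measurable_rv_le.
have Pno : P no_fast_line = ((1 - F t1) ^+ N)%:E.
  by apply: (prob_all_gt tau_iid); [move=> k; exact: integer_line|exact: axial_inj].
have Plow : (P fast_low_line <= ((B.*2.+1 ^ d')%N%:R * F t2)%:E)%E.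
  apply: le_trans (prob_exists_le (r := F t2) _ _) _ => [y|y|].
  - exact: measurable_rv_le.
  - by rewrite (prob_le tau_iid)//; exact: integer_line.
  - by rewrite card_ffun !card_ord.
have Pbad : (P [set w | exists jb, bad_connector jb w] <= (2 * d'%:R * (1 - F M))%:E)%E.
  apply: le_trans (prob_exists_le (r := 1 - F M) _ _) _ => // [jb|].
  - apply: (prob_exists_first_success_bad tau_iid) => [k||k|i k].
    + exact: integer_line.
    + exact: axial_inj.
    + exact: integer_line.
    + exact: axial_line_neq.
  - by rewrite card_prod card_ord card_bool natrM mulrC [_ * 2]mulrC mulrC.
have PGc : (P (~` G) <= ((1 - F t1) ^+ N + 2 * d'%:R * (1 - F M) +
    (B.*2.+1 ^ d')%N%:R * F t2)%:E)%E.
  apply: (@le_trans _ _ (P (below_support `|` (no_fast_line `|`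
      [set w | exists jb, bad_connector jb w] `|` fast_low_line)))).
    apply: le_measure; rewrite ?inE; first exact: measurableC.
      apply: measurableU; first exact: measurable_below_support.
      by apply: measurableU => //; apply: measurableU => //; exact: measurable_exists.
    move=> w /= nG; apply: contrapT => /not_orP[nb /not_orP[/not_orP[nf /forallNP ng] nl]].
    apply: nG; have tw L : integer_lines L -> 0 <= tau L w by move=> /tau_ge0.
    have [u uB|[p0 geo0] hp] := geodesic_heights tw a0 (above_support nb)
        (reach_fast M0 nf ng) (B := B) (t := t2) _ t20 t12.
      have [y ->] := axial_line_box uB; rewrite leNgt; apply/negP => /ltW yt.
      by apply: nl; exists y.
    (* The lower bound on the supremum requires some geodesic to exist; the upper bound concerns all
       of them. *)
    apply/andP; split.
      apply: (@le_trans _ _ ((height ord0 p0)%:R%:E)); last first.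
        by apply: ereal_sup_ubound; exists p0.
      by rewrite lee_fin (le_trans lB)// ler_nat; have [] := hp _ geo0.
    apply: ge_ereal_sup => _ [p geo <-]; rewrite lee_fin; apply: bP.
    by have [] := hp _ geo.
  have mex : measurable [set w | exists jb, bad_connector jb w] by exact: measurable_exists.
  have mU : measurable (no_fast_line `|` [set w | exists jb, bad_connector jb w]).
    exact: measurableU.
  have mUU := measurableU _ _ mU mlow.
  rewrite !EFinD -Pno; apply: le_trans (measureU2 _ measurable_below_support mUU) _.
  rewrite [X in (X + _)%E]prob_below_support add0e.
  apply: le_trans (measureU2 _ mU mlow) _; apply: leeD => //.
  by apply: le_trans (measureU2 _ mno mex) _; exact: leeD.
have : (P G = 1 - P (~` G))%E by rewrite -probability_setC ?setCK//; exact: measurableC.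
move=> ->; rewrite EFinB; exact: leeB.
Qed.

End FixedScales.
End HeightProbability.

(** * Asymptotics of the scale and of the distribution function *)

Section Asymptotics.
Local Set Implicit Arguments.
Local Unset Strict Implicit.
Local Unset Printing Implicit Defensive.
Context {R : realType}.

Lemma near_le_powR (g A : R) : 0 < g -> \forall n \near \oo, A <= n%:R `^ g.
Proof.
move=> g0; pose x := (`|A| + 1) `^ g^-1; exists (Num.trunc x).+1 => //= n nx.
have xn : x <= n%:R.
  by apply: (le_trans (ltW (truncnS_gt x))); rewrite ler_nat.
apply: (@le_trans _ _ (x `^ g)).
  rewrite -powRrM mulVf ?gt_eqF// powRr1 ?addr_ge0//.
  by rewrite (le_trans (ler_norm A))// lerDl.
by apply: ge0_ler_powR; rewrite ?nnegrE ?powR_ge0// ltW.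
Qed.

Lemma limn_einf_ge (u : (\bar R)^nat) (x : \bar R) :
  (\forall n \near \oo, (x <= u n)%E) -> (x <= limn_einf u)%E.
Proof.
move=> [N _ xu]; rewrite limn_einf_lim; apply: lime_ge; first exact: is_cvg_einfs.
exists N => // n /= Nn; apply: le_ereal_inf_tmp => _ [k /= nk <-].
by apply: xu; rewrite /= (leq_trans Nn).
Qed.

(** The Bernoulli-type bound [(1 - p) ^+ k * (1 + k%:R * p) <= 1], proved by induction, suffices in
    place of an exponential estimate. *)
Lemma failures_le (p s : R) (N : nat) : 0 <= p <= 1 -> 0 < s -> s <= N%:R * p ->
  (1 - p) ^+ N <= s^-1.
Proof.
move=> /andP[p0 p1] s0 sNp.
have q0 k : 0 <= (1 - p) ^+ k by rewrite exprn_ge0// subr_ge0.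
have bern k : (1 - p) ^+ k * (1 + k%:R * p) <= 1.
  elim: k => [|k IH]; first by rewrite expr0 mul1r mul0r addr0.
  apply: le_trans IH; rewrite exprSr -mulrA ler_wpM2l// -[k.+1]addn1 natrD.
  have : 0 <= k%:R * p * p by rewrite !mulr_ge0.
  nra.
rewrite -[leRHS]mul1r ler_pdivlMr//; apply: le_trans (bern N).
by rewrite ler_wpM2l// (le_trans sNp)// lerDr.
Qed.

Section Scaling.
Variables (D : nat) (beta : R).
Hypotheses (D0 : (0 < D)%N) (beta0 : 0 < beta).

(** [D] stands for d - 1, the number of transversal directions. *)
Definition scale (n : nat) : R := n%:R `^ (beta / (beta + D%:R)).

Lemma scale_gt0 n : (0 < n)%N -> 0 < scale n.
Proof. by move=> n0; rewrite powR_gt0// ltr0n. Qed.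

Lemma near_le_scale A : \forall n \near \oo, A <= scale n.
Proof. by apply: near_le_powR; rewrite divr_gt0// addr_gt0// ltr0n. Qed.

Lemma scale_div n : (0 < n)%N -> scale n / n%:R = (n%:R `^ (D%:R / (beta + D%:R)))^-1.
Proof.
move=> n0; have nz : n%:R != 0 :> R by rewrite pnatr_eq0 -lt0n.
rewrite -powRN -{1}(powRr1 (ler0n R n)) -powRN /scale -powRD ?nz ?implybT//.
congr (_ `^ _); have : beta + D%:R != 0 by rewrite gt_eqF// addr_gt0// ltr0n.
by move=> ?; field.
Qed.

Lemma near_scale_div_lt (e : R) : 0 < e -> \forall n \near \oo, scale n / n%:R < e.
Proof.
move=> e0; near=> n; have n0 : (0 < n)%N by near: n; exact: nbhs_infty_gt.
rewrite scale_div// invf_plt ?posrE ?powR_gt0 ?ltr0n//.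
apply: (@lt_le_trans _ _ (e^-1 + 1)); first by rewrite ltrDl.
by near: n; apply: near_le_powR; rewrite divr_gt0 ?addr_gt0 ?ltr0n.
Unshelve. all: by end_near. Qed.

(* The balance that determines the exponent. *)
Lemma scale_div_powR n : (0 < n)%N -> (scale n / n%:R) `^ beta = (scale n ^+ D)^-1.
Proof.
move=> n0; rewrite scale_div// -powRN -powRrM -powR_mulrn ?powR_ge0// /scale.
rewrite -powRrM -powRN; congr (_ `^ _).
have : beta + D%:R != 0 by rewrite gt_eqF// addr_gt0// ltr0n.
by move=> ?; field.
Qed.

End Scaling.

(** Since the ratio tends to 1, it eventually lies between 1/2 and 2; only this comparison up to
    constants is used later. *)
Lemma cdf_near_support (F : R -> R) (a beta c : R) : 0 < c ->
  F t / (c * (t - a) `^ beta) @[t --> a^'+] --> (1 : R) ->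
  exists2 r, 0 < r & forall x, 0 < x < r ->
    c / 2 * x `^ beta <= F (a + x) <= 2 * c * x `^ beta.
Proof.
move=> c0 Fequiv.
have [r /= r0 lower] : \forall t \near a^'+, 2^-1 < F t / (c * (t - a) `^ beta).
  by apply: (cvgr_gt _ Fequiv); rewrite invf_lt1// ltr1n.
have [r' /= r'0 upper] : \forall t \near a^'+, F t / (c * (t - a) `^ beta) < 2.
  by apply: (cvgr_lt _ Fequiv); rewrite ltr1n.
exists (Num.min r r'); first by rewrite lt_min r0.
move=> x /andP[x0]; rewrite lt_min => /andP[xr xr'].
have axa : a < a + x by rewrite ltrDl.
have close e : x < e -> `|a - (a + x)| < e.
  by move=> xe; rewrite opprD addrA subrr sub0r normrN gtr0_norm.
have := lower (a + x) (close _ xr) axa; have := upper (a + x) (close _ xr') axa.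
rewrite /= addrAC subrr add0r.
have d0 : 0 < c * x `^ beta by rewrite mulr_gt0// powR_gt0.
rewrite ltr_pdivrMr// ltr_pdivlMr// => /ltW up /ltW low.
apply/andP; split; lra.
Qed.

(** This supplies the constant [M] that bounds the connectors, whatever the scale. *)
Lemma cdf_tail (dT : measure_display) (T : measurableType dT) (P : probability T R)
  (X : {RV P >-> R}) (F : R -> R) (e : R) : (forall t, cdf X t = (F t)%:E) -> 0 < e ->
  exists2 M, 0 <= M & 1 - F M <= e.
Proof.
move=> XF e0; have := cvg_cdfy1 X => /fine_cvgP[_ /cvgr_gt].
move=> /(_ (1 - e)); rewrite ltrBlDr ltrDl => /(_ e0) FM.
have FM0 : \forall x \near +oo, 0 <= x /\ 1 - e < (fine \o cdf X) x.
  by apply: filterI => //; exact: nbhs_pinfty_ge.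
have [M [M0]] := @filter_ex _ _ _ _ FM0.
by rewrite /= XF /= => eM; exists M => //; lra.
Qed.

End Asymptotics.

(** * Choice of the constants and tightness of the rescaled height *)

Lemma max_height_tight (R : realType) (d' : nat) (d'_gt0 : (0 < d')%N)
    (dT : measure_display) (T : measurableType dT) (P : probability T R)
    (tau : set 'rV[int]_d'.+1 -> {RV P >-> R}) (F : R -> R) (a beta c eta : R) :
  iid_with_cdf (@integer_lines d'.+1) tau F ->
  (forall L, integer_lines L -> forall w, 0 <= tau L w) ->
  is_support_inf F a -> 0 < a -> 0 < beta -> 0 < c -> 0 < eta ->
  F t / (c * (t - a) `^ beta) @[t --> a^'+] --> (1 : R) ->
  exists eps K : R, 0 < eps /\ 0 < K /\
    \forall n \near \oo, ((1 - eta)%:E <=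
      P [set w | ((eps * scale d' beta n)%:E <=
        max_height (fun L => tau L w) ord0 n <= (K * scale d' beta n)%:E)%E])%E.
Proof.
move=> tau_iid tau_ge0 Fa a0 beta0 c0 eta0 Fequiv.
have [r r0 Fr] := cdf_near_support c0 Fequiv.
pose D : R := d'%:R; have D1 : 1 <= D by rewrite ler1n.
have lineD i : integer_lines (line (0 : 'rV[int]_d'.+1) i) := integer_line 0 i.
have F01 t : 0 <= F t <= 1 := cdf_ge0_le1 tau_iid t (lineD ord0).
(* The allowance [eta] is split into thirds, one per error term. Here each of the [2 * D] connectors
   receives an equal share of one third. *)
have [M M0 FM] : exists2 M, 0 <= M & 1 - F M <= eta / 3 / (2 * D).
  apply: (cdf_tail (X := tau (line 0 ord0))) => [t|]; first exact: tau_iid.2.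
  by rewrite !divr_gt0// mulr_gt0// (lt_le_trans ltr01).
(* About [C1 * h ^+ d'] candidates, each fast with probability at least [c / 2 / h ^+ d'], give an
   expected number of fast lines of at least [3 / eta]. *)
pose C1 : R := 1 + 6 / (c * eta).
have C11 : 1 <= C1 by rewrite lerDl divr_ge0// mulr_ge0// ltW.
(* The excess time over [a * n] is [h] along the fast line plus the two staircases of side at most
   [C1 * h]. *)
pose C : R := 1 + 2 * D * C1 * M.
have C0 : 1 <= C by rewrite lerDl !mulr_ge0//; lra.
have [C_gt0 C2_gt0] : 0 < C /\ 0 < 2 * C by lra.
(* [g / h ^+ d'] will bound the probability that a given line has time at most [a + 2 * C * x]. *)
pose g : R := 2 * c * (2 * C) `^ beta.
have g0 : 0 < g by rewrite !mulr_gt0// powR_gt0.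
(* One value that satisfies both [3 * eps <= 1] and [3 * eps * g <= eta / 3]. *)
pose eps : R := (3 + 9 * g / eta)^-1.
have ge0 : 0 < 9 * g / eta by rewrite divr_gt0// mulr_gt0.
have eps0 : 0 < eps by rewrite invr_gt0; lra.
have eps3 : 3 * eps <= 1 by rewrite ler_pdivrMr; lra.
have epsg : 3 * eps * g <= eta / 3.
  rewrite /eps mulrAC ler_pdivrMr; last lra.
  have -> : eta / 3 * (3 + 9 * g / eta) = eta + 3 * g by field; rewrite gt_eqF.
  lra.
exists eps, (C / a); split=> //; split; first by rewrite divr_gt0.
have [C1_gt0 D_gt0] : 0 < C1 /\ 0 < D by lra.
have eps3_ge0 : 0 <= 3 * eps by lra.
have c2_gt0 : 0 < c / 2 by lra.
near=> n; set h := scale d' beta n; pose x := h / n%:R.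
have n0 : (0 < n)%N by near: n; exact: nbhs_infty_gt.
have nR : 0 < n%:R :> R by rewrite ltr0n.
have h0 : 0 < h by exact: scale_gt0.
have x0 : 0 < x by rewrite divr_gt0.
(* This makes the estimate of [F] available at both levels, [a + x] and [a + 2 * C * x]. *)
have xr : 2 * C * x < r.
  rewrite mulrC -ltr_pdivlMr//.
  by rewrite /x /h; near: n; apply: near_scale_div_lt => //; rewrite divr_gt0.
(* It absorbs the odd unit: [B.*2.+1] is then at most [3 * eps * h]. *)
have eh : 1 <= eps * h.
  rewrite mulrC -ler_pdivrMr// div1r.
  by rewrite /h; near: n; exact: near_le_scale.
have nx : n%:R * x = h by rewrite mulrC divfK// gt_eqF.
have xb : x `^ beta = (h ^+ d')^-1 by exact: scale_div_powR.
have hd0 : 0 < h ^+ d' by rewrite exprn_gt0.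
(* Truncation serves twice: [m] is at most [C1 * h] for the length of connectors, and [m.+1] exceeds
   it for the number of candidates. *)
pose m := Num.trunc (C1 * h); pose B := Num.trunc (eps * h).
have C1h : 0 <= C1 * h by rewrite mulr_ge0// ltW.
have mle : m%:R <= C1 * h by rewrite truncn_le.
have Ble : B%:R <= eps * h by rewrite truncn_le// mulr_ge0// ltW.
(* As [d'] is positive, [C1 ^+ d'] may be replaced by [C1], and [(3 * eps) ^+ d'] by [3 * eps]. *)
have pow_ge (y : R) : 1 <= y -> y <= y ^+ d'.
  by move=> y1; rewrite -{1}(expr1 y) ler_weXn2l.
have pow_le (y : R) : 0 <= y -> y <= 1 -> y ^+ d' <= y.
  by move=> y0 y1; rewrite -{2}(expr1 y) ler_wiXn2l.
have miss : (1 - F (a + x)) ^+ (m.+1 ^ d') <= eta / 3.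
  have -> : eta / 3 = (3 / eta)^-1 by rewrite invf_div.
  apply: failures_le => //; first by rewrite divr_gt0.
  have /andP[low _] : c / 2 * x `^ beta <= F (a + x) <= 2 * c * x `^ beta.
    by apply: Fr; rewrite x0 /= (le_lt_trans _ xr)// ler_peMl //; [exact: ltW|clear -C0; lra].
  have Nm : C1 * h ^+ d' <= (m.+1 ^ d')%:R.
    apply: (@le_trans _ _ ((C1 * h) ^+ d')).
      by rewrite exprMn ler_pM2r// pow_ge.
    by rewrite natrX lerXn2r ?nnegrE// ltW// truncnS_gt.
  apply: (@le_trans _ _ (C1 * h ^+ d' * (c / 2 * x `^ beta))); last first.
    by apply: ler_pM => //; rewrite mulr_ge0 ?powR_ge0// ltW.
  rewrite xb (_ : C1 * h ^+ d' * (c / 2 * (h ^+ d')^-1) = C1 * c / 2).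
    rewrite /C1; have -> : (1 + 6 / (c * eta)) * c / 2 = c / 2 + 3 / eta.
      by field; rewrite !gt_eqF.
    by rewrite lerDr ltW.
  by field; rewrite gt_eqF.
have low : (B.*2.+1 ^ d')%N%:R * F (a + 2 * C * x) <= eta / 3.
  have x20 : 0 < 2 * C * x by rewrite mulr_gt0.
  have /andP[_ up] := Fr (2 * C * x) (introT andP (conj x20 xr)).
  apply: le_trans epsg.
  have B3 : (B.*2.+1 ^ d')%N%:R <= 3 * eps * h ^+ d'.
    apply: (@le_trans _ _ ((3 * eps * h) ^+ d')).
      rewrite natrX lerXn2r ?nnegrE// ?mulr_ge0 ?(ltW h0) ?(ltW eps0)//.
      by rewrite -[B.*2.+1]addn1 natrD -mul2n natrM; clear -eh Ble; lra.
    by rewrite exprMn ler_wpM2r ?pow_le// ltW.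
  apply: (@le_trans _ _ (3 * eps * h ^+ d' * (2 * c * (2 * C * x) `^ beta))).
    by apply: ler_pM => //; have /andP[] := F01 (a + 2 * C * x).
  rewrite powRM ?xb ?(ltW C2_gt0) ?(ltW x0)//.
  rewrite /g le_eqVlt; apply/orP; left; apply/eqP; field.
  by rewrite gt_eqF.
have time : n%:R * (a + x) + 2 * D * m%:R * M <= n%:R * a + C * h.
  rewrite mulrDr nx /C -addrA lerD2l [leRHS]mulrDl mul1r lerD2l.
  have -> : 2 * D * C1 * M * h = 2 * D * (C1 * h) * M by ring.
  by apply: ler_wpM2r => //; apply: ler_wpM2l; rewrite ?mulr_ge0// ltW.
apply: le_trans (prob_height_ge (n := n) (m := m) (B := B) (t1 := a + x)
  (t2 := a + 2 * C * x) (M := M) tau_iid tau_ge0 Fa a0 M0 _ _ _ _).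
- rewrite lee_fin lerD2l lerN2.
  have conn : 2 * D * (1 - F M) <= eta / 3.
    by rewrite mulrC -ler_pdivlMr// mulr_gt0.
  have -> : eta = eta / 3 + eta / 3 + eta / 3 by clear; field.
  exact: lerD (lerD miss conn) low.
- by apply: addr_ge0; [exact: ltW|apply: mulr_ge0; exact: ltW].
(* The route costs at most [C * h] above [a * n], whereas the slow lines near the axis would cost
   [2 * C * h]. *)
- apply: le_lt_trans time _; rewrite mulrDr ltrD2l mulrCA nx.
  by rewrite ltr_pM2r//; clear -C_gt0; lra.
- exact/ltW/truncnS_gt.
(* Cancelling [a * n] leaves [a * k <= C * h], whence the constant [C / a]. *)
- move=> k /le_trans/(_ time); rewrite natrD mulrDr [a * n%:R]mulrC lerD2l => ak.
  by rewrite mulrAC ler_pdivlMr// mulrC.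
Unshelve. all: by end_near. Qed.

Theorem theorem2p5 (R : realType) (d : nat) (hd : (2 <= d)%N)
    (dT : measure_display) (T : measurableType dT) (P : probability T R)
    (tau : set 'rV[int]_d -> {RV P >-> R}) (F : R -> R) (a beta c : R)
    (tau_iid : iid_with_cdf (@integer_lines d) tau F)
    (tau_ge0 : forall L, integer_lines L -> forall w, 0 <= tau L w)
    (Fa : is_support_inf F a)
    (a_gt0 : 0 < a) (beta_gt0 : 0 < beta) (c_gt0 : 0 < c)
    (F_equiv : F t / (c * (t - a) `^ beta) @[t --> a^'+] --> (1 : R))
    (dS : measure_display) (S : measurableType dS) (Q : probability S R)
    (sigma : 'I_d -> {RV Q >-> R})
    (sigma_iid : iid_with_cdf [set: 'I_d] sigma F)
    (moment : (\int[Q]_w \big[Order.min/+oo]_(i < d) ((sigma i w) ^+ d)%:E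
               < +oo)%E) :
  forall eta : R, 0 < eta ->
  exists eps K : R, 0 < eps /\ 0 < K /\
    let h (n : nat) : R := n%:R `^ (beta / (beta + d%:R - 1)) in
    let H (n : nat) (w : T) : \bar R :=
      max_height (fun L => tau L w) (Ordinal (ltnW hd)) n in
    ((1 - eta)%:E <= limn_einf (fun n : nat =>
       P [set w | (eps * h n)%:E <= H n w <= (K * h n)%:E]))%E.
Proof.
move=> eta eta_gt0; clear sigma sigma_iid moment.
case: d hd tau tau_iid tau_ge0 => // d' hd tau tau_iid tau_ge0.
have [eps [K [eps0 [K0 tight]]]] :=
  max_height_tight _ _ hd _ _ _ _ _ _ _ _ _ tau_iid tau_ge0 Fa a_gt0
  beta_gt0 c_gt0 eta_gt0 F_equiv.
exists eps, K; split=> //; split=> //=.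
have -> : Ordinal (ltnW hd) = ord0 by exact: val_inj.
have -> : beta + d'.+1%:R - 1 = beta + d'%:R by rewrite -natr1; ring.
exact: limn_einf_ge.
Qed.
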